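(* Let $F:\mathbb{C}^n\to\mathbb{C}^m$, $n\ge2$, be a polynomial mapping and let $S\subset\mathbb{C}^n$ be an unbounded algebraic set. The mapping $F|S:S\to\mathbb{C}^m$ is proper if and only if $\mathcal{L}_\infty(F|S)>0$.
   Context: With $|\cdot|$ the maximum norm, for a polynomial mapping $F:\mathbb{C}^n\to\mathbb{C}^m$ and an unbounded algebraic set $S\subset\mathbb{C}^n$ put $$N(F|S):=\{\nu\in\mathbb{R} : \exists A>0,\ \exists B>0,\ \forall z\in S,\ (|z|>B\Rightarrow A|z|^\nu\le|F(z)|)\}.$$ The Łojasiewicz exponent at infinity of $F|S$ is $\mathcal{L}_\infty(F|S):=\sup N(F|S)$, with the convention $\sup\emptyset=-\infty$. Proper means that preimages of compact sets are compact (in the Euclidean topology). *)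

(* Defs.v *)
From HB Require Import structures.
From mathcomp Require Import all_boot all_order all_algebra.
From mathcomp Require Import all_classical all_reals all_analysis.
From mathcomp Require Import complex.
(* The notations of mpoly clash with those of MathComp-Analysis. *)
From mathcomp Require Import -(notations) mpoly.

Set Implicit Arguments.
Unset Strict Implicit.
Unset Printing Implicit Defensive.

Import Order.TTheory GRing.Theory Num.Theory.
Import numFieldNormedType.Exports.

Local Open Scope ring_scope.
Local Open Scope complex_scope.
Local Open Scope classical_set_scope.

(* MathComp-Analysis topologizes abstract numeric fields but not complex: R[i]
   gets the topology of its modulus, so that 'rV[R[i]]_n, which stands for C^n,
   carries the Euclidean topology. *)
HB.instance Definition _ (R : realType) := PseudoPointedMetric.copy R[i] R[i]^o.
HB.instance Definition _ (R : realType) := NormedModule.copy R[i] R[i]^o.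

Definition polynomial_mapping (R : realType) (n m : nat)
    (F : 'rV[R[i]]_n -> 'rV[R[i]]_m) : Prop :=
  exists p : 'I_m -> mpoly n R[i],
    forall (z : 'rV[R[i]]_n) (j : 'I_m),
      F z ord0 j = meval (fun k => z ord0 k) (p j).

Definition algebraic_set (R : realType) (n : nat) (S : set 'rV[R[i]]_n) : Prop :=
  exists (l : nat) (p : 'I_l -> mpoly n R[i]),
    S = [set z | forall j : 'I_l, meval (fun k => z ord0 k) (p j) = 0].

(* The norm of the library on 'rV[R[i]]_n takes its values in R[i]; real
   exponents require a maximum norm with values in R. The two norms agree by
   max_normE. *)
Definition max_norm (R : realType) (n : nat) (z : 'rV[R[i]]_n) : R :=
  \big[Order.max/0]_(k < n) ComplexField.Normc.normc (z ord0 k).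

Lemma max_normE (R : realType) (n : nat) (z : 'rV[R[i]]_n) :
  (max_norm z)%:C = `|z|.
Proof.
have normcE (x : R[i]) : (ComplexField.Normc.normc x)%:C = `|x| by [].
have zReal : `|z| = (complex.Re `|z|)%:C.
  by have := normr_ge0 z; case: `|z| => a b; rewrite lecE /= => /andP[/eqP ->].
apply/le_anti/andP; split.
  rewrite zReal lecR; apply/bigmax_le => [|k _]; rewrite -lecR -zReal ?normr_ge0//.
  rewrite normcE [leRHS]/Num.norm /= mx_normE -[leLHS]nngE num_le.
  exact: (le_bigmax _ (fun ij : 'I_1 * 'I_n => `|z ij.1 ij.2|%:nng) (ord0, k)).
rewrite [leLHS]/Num.norm /=; have [->|/mx_norm_neq0[[i k]]] := eqVneq (mx_norm z) 0.
  by rewrite lecR; exact: bigmax_ge_id.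
by rewrite (ord1 i) /= => ->; rewrite -normcE lecR; exact: le_bigmax.
Qed.

Definition lojasiewicz_exponents (R : realType) (n m : nat)
    (F : 'rV[R[i]]_n -> 'rV[R[i]]_m) (S : set 'rV[R[i]]_n) : set R :=
  [set nu | exists2 A : R, 0 < A & exists2 B : R, 0 < B &
    forall z, S z -> B < max_norm z ->
      A * max_norm z `^ nu <= max_norm (F z)].

(* ereal_sup set0 = -oo. *)
Definition lojasiewicz_exponent_infty (R : realType) (n m : nat)
    (F : 'rV[R[i]]_n -> 'rV[R[i]]_m) (S : set 'rV[R[i]]_n) : \bar R :=
  ereal_sup (EFin @` lojasiewicz_exponents F S).

Definition proper_mapping (T U : topologicalType) (f : T -> U) : Prop :=
  forall K : set U, compact K -> compact (f @^-1` K).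

(* Main.v *)
(* If F|S is proper, then for every real a the z in S with |F(z)_j|^2 <= a for
   all j form a bounded set.  By Tarski's quantifier elimination, the set of
   pairs (a, x) such that some z in S has |F(z)_j|^2 <= a for all j and
   |z_k|^2 >= x for some k is a Boolean combination of sign conditions on
   finitely many polynomials in (a, x).  Each of these polynomials has constant
   sign on a region {a >= T, x >= a^D}, so that membership is constant there; as
   it fails for x large, it fails on the whole region.  Hence |z|^2 < a^D for
   a = max(T, |F(z)|^2), that is |F(z)| >= |z|^(1/(D+1)) for |z| large.
   Conversely, a positive exponent bounds the preimages of bounded sets. *)
Require Import Defs.
From mathcomp Require Import all_boot all_order all_algebra.
From mathcomp Require Import all_classical all_reals all_analysis.
From mathcomp Require Import complex.
From mathcomp Require Import -(notations) mpoly.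
From mathcomp Require Import ordered_qelim qe_rcf.
From mathcomp Require Import lra.
Import Order.TTheory GRing.Theory Num.Theory.
Import numFieldNormedType.Exports.
Local Open Scope ring_scope.
Local Open Scope complex_scope.
Local Open Scope classical_set_scope.

Set Implicit Arguments.
Unset Strict Implicit.
Unset Printing Implicit Defensive.

Local Notation normc := ComplexField.Normc.normc.

(** * Two-variable polynomials at infinity *)

(** The regions [T <= a], [a ^+ D <= x] serve as neighbourhoods of infinity. The clause [1 <= T]
    makes [a ^+ D] grow with [D], so that two regions meet in a third. *)
Definition poly_eventually (R : realFieldType) (P : R -> R -> Prop) :=
  exists (T : R) (D : nat), 1 <= T /\
    forall a x, T <= a -> a ^+ D <= x -> P a x.

Lemma poly_eventuallyS (R : realFieldType) (P Q : R -> R -> Prop) :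
  (forall a x, P a x -> Q a x) -> poly_eventually P -> poly_eventually Q.
Proof.
move=> PQ [T [D [T1 PTD]]]; exists T, D; split=> // a x Ta ax.
exact/PQ/PTD.
Qed.

Lemma poly_eventuallyI (R : realFieldType) (P Q : R -> R -> Prop) :
  poly_eventually P -> poly_eventually Q ->
  poly_eventually (fun a x => P a x /\ Q a x).
Proof.
move=> [T [D [T1 PTD]]] [T' [D' [T1' PTD']]].
exists (Num.max T T'), (maxn D D'); split; first by rewrite le_max T1.
move=> a x; rewrite ge_max => /andP[Ta T'a] ax.
have a1 : 1 <= a by exact: le_trans Ta.
split; [apply: PTD|apply: PTD'] => //; apply: le_trans ax;
  by rewrite ler_weXn2l// ?leq_maxl ?leq_maxr.
Qed.

Lemma poly_le_exp (R : realFieldType) (c : {poly R}) :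
  exists2 M : R, 0 <= M & exists e : nat,
    forall a, 1 <= a -> `|c.[a]| <= M * a ^+ e.
Proof.
elim/poly_ind: c => [|q k [M M0 [e qM]]].
  by exists 0 => //; exists 0%N => a _; rewrite horner0 normr0 mul0r.
exists (M + `|k|); first by rewrite addr_ge0.
exists e.+1 => a a1; rewrite hornerMXaddC (le_trans (ler_normD _ _))// mulrDl.
have a0 : 0 <= a by exact: le_trans a1.
rewrite lerD//.
  by rewrite normrM exprSr mulrA (ger0_norm a0) ler_wpM2r// qM.
by rewrite ler_peMr// exprn_ege1.
Qed.

(** Horner induction on [q * 'X + k]: once [eps * a >= eps + |k|], the constant [k] can neither
    change the sign given by [q] nor push the absolute value below [eps]. *)
Lemma poly_neq0_away0 (R : realFieldType) (c : {poly R}) : c != 0 ->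
  exists (s : bool) (eps T : R), [/\ 0 < eps, 1 <= T &
    forall a, T <= a -> eps <= (-1) ^+ s * c.[a]].
Proof.
elim/poly_ind: c => [|q k IH]; first by rewrite eqxx.
have [->|q0 _] := eqVneq q 0.
  rewrite mul0r add0r polyC_eq0 => k0; exists (k < 0), `|k|, 1; split=> //.
    by rewrite normr_gt0.
  by move=> a _; rewrite hornerC -normrEsign.
have [s [eps [T [eps0 T1 qT]]]] := IH q0.
exists s, eps, (Num.max T ((eps + `|k|) / eps)).
split=> //; first by rewrite le_max T1.
move=> a; rewrite ge_max ler_pdivrMr// => /andP[Ta ka].
have a0 : 0 <= a by rewrite (le_trans _ Ta)// (le_trans _ T1).
rewrite hornerMXaddC mulrDr mulrA.
have := ler_wpM2r a0 (qT _ Ta).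
have : - `|k| <= (-1) ^+ s * k.
  by rewrite lerNl -mulrN (le_trans (ler_norm _))// normrMsign normrN.
lra.
Qed.

(** Horner induction in the outer variable [x], the coefficients being polynomials in [a]. The last
    coefficient is at most [M * a ^+ e] in absolute value, and the leading part is at least
    [eps * x], which dominates as soon as [x >= a ^+ e.+1] and [a] is large. *)
Lemma bipoly_neq0_away0 (R : realFieldType) (P : {poly {poly R}}) : P != 0 ->
  exists (s : bool) (eps : R), 0 < eps /\
    poly_eventually (fun a x => eps <= (-1) ^+ s * P.[x%:P].[a]).
Proof.
elim/poly_ind: P => [|Q c IH]; first by rewrite eqxx.
have [->|Q0 _] := eqVneq Q 0.
  rewrite mul0r add0r polyC_eq0 => /poly_neq0_away0[s [eps [T [eps0 T1 cT]]]].
  exists s, eps; split=> //; exists T, 0%N; split=> // a x Ta _.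
  by rewrite hornerC cT.
have [s [eps [eps0 [T [D [T1 QTD]]]]]] := IH Q0.
have [M M0 [e cM]] := poly_le_exp c.
exists s, eps; split=> //.
(* The exponent [e.+1] leaves a spare factor [a], and [a * eps >= eps + M] then gives [eps * x >=
   (eps + M) * a ^+ e >= eps + M * a ^+ e]. *)
exists (Num.max T ((eps + M) / eps)), (maxn D e.+1).
split; first by rewrite le_max T1.
move=> a x; rewrite ge_max ler_pdivrMr// => /andP[Ta Ma] ax.
have a1 : 1 <= a by exact: le_trans Ta.
have ae1 : 1 <= a ^+ e by exact: exprn_ege1.
have xe : a * a ^+ e <= x.
  by rewrite -exprS (le_trans _ ax)// ler_weXn2l// leq_maxr.
have /(QTD _ _ Ta) QD : a ^+ D <= x.
  by rewrite (le_trans _ ax)// ler_weXn2l// leq_maxl.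
rewrite hornerMXaddC hornerD hornerM hornerC mulrDr mulrA.
have x0 : 0 <= x by rewrite (le_trans _ ax)// exprn_ge0// (le_trans _ a1).
have := ler_wpM2r x0 QD.
have : - `|c.[a]| <= (-1) ^+ s * c.[a].
  by rewrite lerNl -mulrN (le_trans (ler_norm _))// normrMsign normrN.
have := cM _ a1.
have : eps * (a * a ^+ e) <= eps * x by rewrite ler_pM2l.
have : (eps + M) * a ^+ e <= a * eps * a ^+ e.
  by rewrite ler_wpM2r// (le_trans _ ae1).
have : eps * 1 <= eps * a ^+ e by rewrite ler_pM2l.
nra.
Qed.

Lemma bipoly_sgr_const (R : realFieldType) (P : {poly {poly R}}) :
  exists s : R, poly_eventually (fun a x => Num.sg P.[x%:P].[a] = s).
Proof.
have [->|/bipoly_neq0_away0[s [eps [eps0 PTD]]]] := eqVneq P 0.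
  by exists 0, 1, 0%N; split=> // a x _ _; rewrite !horner0 sgr0.
exists ((-1) ^+ s); apply: poly_eventuallyS PTD => a x Pax.
have := lt_le_trans eps0 Pax; case: s {Pax}.
  by rewrite mulN1r oppr_gt0 => /ltr0_sg.
by rewrite mul1r => /gtr0_sg.
Qed.

Lemma rterm_bipoly (R : realFieldType) (t : GRing.term R) : GRing.rterm t ->
  exists P : {poly {poly R}},
    forall a x, GRing.eval [:: a; x] t = P.[x%:P].[a].
Proof.
elim: t => //=.
(* Variable 0 is [a], the inner variable, and variable 1 is [x], the outer one; any further variable
   reads the default 0 of the list. *)
- move=> [|[|i]] _; [exists ('X)%:P|exists 'X|exists 0] => a x /=.
  + by rewrite hornerC hornerX.
  + by rewrite hornerX hornerC.
  + by rewrite nth_nil !horner0.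
- by move=> c _; exists c%:P%:P => a x; rewrite !hornerC.
- move=> k _; exists k%:R => a x.
  by rewrite -polyC_natr hornerC hornerMn hornerC.
- move=> t IHt u IHu /andP[/IHt[P tP] /IHu[Q uQ]].
  by exists (P + Q) => a x; rewrite tP uQ !hornerD.
- by move=> t IHt /IHt[P tP]; exists (- P) => a x; rewrite tP !hornerN.
- by move=> t IHt k /IHt[P tP]; exists (P *+ k) => a x; rewrite tP !hornerMn.
- move=> t IHt u IHu /andP[/IHt[P tP] /IHu[Q uQ]].
  by exists (P * Q) => a x; rewrite tP uQ !hornerM.
- by move=> t IHt k /IHt[P tP]; exists (P ^+ k) => a x; rewrite tP !horner_exp.
Qed.

Lemma rterm_sub_sgr_const (R : realFieldType) (t u : GRing.term R) :
  GRing.rterm t -> GRing.rterm u ->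
  exists s : R, poly_eventually (fun a x =>
    Num.sg (GRing.eval [:: a; x] u - GRing.eval [:: a; x] t) = s).
Proof.
move=> rt ru.
have /rterm_bipoly[P uP] : GRing.rterm (GRing.Add u (GRing.Opp t)).
  by rewrite /= ru.
have [s Ps] := bipoly_sgr_const P; exists s.
by apply: poly_eventuallyS Ps => a x; rewrite -uP.
Qed.

(** An atom comparing [t] and [u] depends only on the sign of [u - t], which is eventually constant;
    connectives are handled by intersecting regions. *)
Lemma qf_eval_const (R : realFieldType) (f : ord.formula R) :
  ord.qf_form f -> ord.rformula f ->
  exists b : bool, poly_eventually (fun a x => ord.qf_eval [:: a; x] f = b).
Proof.
elim: f => //=.
- by move=> b _ _; exists b, 1, 0%N.
- move=> t u _ /andP[rt ru]; have [s Ps] := rterm_sub_sgr_const rt ru.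
  exists (s == 0); apply: poly_eventuallyS Ps => a x <-.
  by rewrite sgr_eq0 subr_eq0 eq_sym.
- move=> t u _ /andP[rt ru]; have [s Ps] := rterm_sub_sgr_const rt ru.
  exists (0 < s); apply: poly_eventuallyS Ps => a x <-.
  by rewrite sgr_gt0 subr_gt0.
- move=> t u _ /andP[rt ru]; have [s Ps] := rterm_sub_sgr_const rt ru.
  exists (0 <= s); apply: poly_eventuallyS Ps => a x <-.
  by rewrite sgr_ge0 subr_ge0.
- move=> f IHf g IHg /andP[qf qg] /andP[rf rg].
  have [b fb] := IHf qf rf; have [c gc] := IHg qg rg; exists (b && c).
  by apply: poly_eventuallyS (poly_eventuallyI fb gc) => a x [-> ->].
- move=> f IHf g IHg /andP[qf qg] /andP[rf rg].
  have [b fb] := IHf qf rf; have [c gc] := IHg qg rg; exists (b || c).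
  by apply: poly_eventuallyS (poly_eventuallyI fb gc) => a x [-> ->].
- move=> f IHf g IHg /andP[qf qg] /andP[rf rg].
  have [b fb] := IHf qf rf; have [c gc] := IHg qg rg; exists (b ==> c).
  by apply: poly_eventuallyS (poly_eventuallyI fb gc) => a x [-> ->].
- move=> f IHf qf rf; have [b fb] := IHf qf rf; exists (~~ b).
  by apply: poly_eventuallyS fb => a x ->.
Qed.

(** * Definable sets and functions *)

Definition definable (R : rcfType) (P : seq R -> Prop) :=
  exists f : ord.formula R, forall e, ord.holds e f <-> P e.

(** After quantifier elimination the truth value is a constant [b] on some region. Every vertical
    line with [a >= T] contains points of the region with [x] arbitrarily large, where [P] fails;
    hence [b] is false. *)
Lemma definable_poly_bounded (R : rcfType) (P : seq R -> Prop) :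
  definable P ->
  (forall a, exists b, forall x, b <= x -> ~ P [:: a; x]) ->
  poly_eventually (fun a x => ~ P [:: a; x]).
Proof.
move=> [f fP] Pbnd.
have [b [T [D [T1 TD]]]] : exists b : bool,
    poly_eventually (fun a x => rcf_sat [:: a; x] f = b).
  (* [rcf_sat] evaluates the formula left by elimination, which has neither quantifiers nor
     inverses. *)
  have := ord.quantifier_elim_wf (@wf_QE_wproj R) (ord.to_rform_rformula f).
  by move=> /andP[]; exact: qf_eval_const.
exists T, D; split=> // a x Ta ax /fP/rcf_satP.
have [b' Pb'] := Pbnd a.
(* This abscissa lies both in the region and beyond the bound [b']. *)
rewrite TD// => bT; apply: (Pb' (Num.max b' (a ^+ D))).
  by rewrite le_max lexx.
by apply/fP/rcf_satP; rewrite TD// le_max lexx orbT.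
Qed.

Section definability.
Variable R : rcfType.
Implicit Types (g h : seq R -> R) (P Q : seq R -> Prop) (c d : seq R -> R[i]%C).

Lemma definable_and P Q :
  definable P -> definable Q -> definable (fun e => P e /\ Q e).
Proof.
by move=> [f fP] [f' fQ]; exists (ord.And f f') => e /=; rewrite fP fQ.
Qed.

Lemma definable_or P Q :
  definable P -> definable Q -> definable (fun e => P e \/ Q e).
Proof.
by move=> [f fP] [f' fQ]; exists (ord.Or f f') => e /=; rewrite fP fQ.
Qed.

Lemma definable_ext P Q :
  (forall e, P e <-> Q e) -> definable P -> definable Q.
Proof. by move=> PQ [f fP]; exists f => e; rewrite fP. Qed.

Lemma definable_forall_ord (k : nat) (P : 'I_k -> seq R -> Prop) :
  (forall i, definable (P i)) -> definable (fun e => forall i, P i e).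
Proof.
move=> dP.
suff [f fP] : definable (fun e => forall i, i \in enum 'I_k -> P i e).
  by exists f => e; rewrite fP; split=> + i; [apply; rewrite mem_enum|].
elim: (enum 'I_k) => [|i s IH]; first by exists (ord.Bool true).
apply: definable_ext (definable_and (dP i) IH) => e; split=> [[Pi Ps] j|Ps].
  by rewrite inE => /predU1P[->|/Ps].
by split=> [|j js]; apply: Ps; rewrite inE ?eqxx ?js ?orbT.
Qed.

Lemma definable_exists_ord (k : nat) (P : 'I_k -> seq R -> Prop) :
  (forall i, definable (P i)) -> definable (fun e => exists i, P i e).
Proof.
move=> dP.
suff [f fP] : definable (fun e => exists2 i, i \in enum 'I_k & P i e).
  exists f => e; rewrite fP.
  by split=> [[i _ Pi]|[i Pi]]; exists i; rewrite ?mem_enum.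
elim: (enum 'I_k) => [|i s IH].
  by exists (ord.Bool false) => e /=; split=> // -[].
apply: definable_ext (definable_or (dP i) IH) => e; split.
  by move=> [Pi|[j js Pj]]; [exists i|exists j]; rewrite ?inE ?eqxx ?js ?orbT.
by move=> [j]; rewrite inE => /predU1P[->|js] Pj; [left|right; exists j].
Qed.

(** A whole block of variables is quantified at once, the witness being an environment that agrees
    with [e] off [s]; this spares nested updates of lists. *)
Lemma definable_exists (s : seq nat) P : definable P ->
  definable (fun e => exists2 e' : seq R,
    (forall i, i \notin s -> e'`_i = e`_i) & P e').
Proof.
move=> [f fP]; exists (foldr (@ord.Exists R) f s) => e.
elim: s e => [|i s IH] e /=.
  split=> [/fP Pe|[e' e'e /fP Pe]]; first by exists e.
  (* The two environments have the same entries but may differ in length by trailing zeros. *)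
  by apply: ord.eq_holds Pe => j; exact: e'e.
split=> [[x /IH[e' e'e Pe']]|[e' e'e Pe']].
  exists e' => // j; rewrite inE negb_or => /andP[ji js].
  by rewrite e'e// nth_set_nth /= (negbTE ji).
exists (e'`_i); apply/IH; exists e' => // j js.
rewrite nth_set_nth /=; case: eqVneq => [->//|ji].
by apply: e'e; rewrite inE negb_or ji.
Qed.

(** Functions are given by terms rather than by definable graphs, so they can be substituted into
    atoms without new quantifiers. *)
Definition definable_fun g :=
  exists t : GRing.term R, forall e, GRing.eval e t = g e.

Lemma definable_nth i : definable_fun (fun e => e`_i).
Proof. by exists (GRing.Var R i). Qed.

Lemma definable_cst (x : R) : definable_fun (fun=> x).
Proof. by exists (GRing.Const x). Qed.

Lemma definable_add g h :
  definable_fun g -> definable_fun h -> definable_fun (fun e => g e + h e).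
Proof.
by move=> [t tg] [u uh]; exists (GRing.Add t u) => e /=; rewrite tg uh.
Qed.

Lemma definable_mul g h :
  definable_fun g -> definable_fun h -> definable_fun (fun e => g e * h e).
Proof.
by move=> [t tg] [u uh]; exists (GRing.Mul t u) => e /=; rewrite tg uh.
Qed.

Lemma definable_opp g : definable_fun g -> definable_fun (fun e => - g e).
Proof. by move=> [t tg]; exists (GRing.Opp t) => e /=; rewrite tg. Qed.

Lemma definable_eq g h :
  definable_fun g -> definable_fun h -> definable (fun e => g e = h e).
Proof.
by move=> [t tg] [u uh]; exists (ord.Equal t u) => e /=; rewrite tg uh.
Qed.

Lemma definable_le g h :
  definable_fun g -> definable_fun h -> definable (fun e => g e <= h e).
Proof. by move=> [t tg] [u uh]; exists (ord.Le t u) => e /=; rewrite tg uh. Qed.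

(** * Complex-valued functions through their real and imaginary parts *)

Definition definable_cfun c :=
  definable_fun (fun e => complex.Re (c e)) /\
  definable_fun (fun e => complex.Im (c e)).

Lemma definable_cfun_ext c d : c =1 d -> definable_cfun c -> definable_cfun d.
Proof.
by move=> cd [[t tc] [u uc]]; split; [exists t|exists u] => e; rewrite -cd.
Qed.

Lemma definable_ccst (z : R[i]) : definable_cfun (fun=> z).
Proof. by split; exact: definable_cst. Qed.

Lemma definable_cadd c d :
  definable_cfun c -> definable_cfun d -> definable_cfun (fun e => c e + d e).
Proof.
move=> [cr ci] [dr di]; split.
  have [t tP] := definable_add cr dr.
  by exists t => e; rewrite tP; case: (c e); case: (d e).
have [t tP] := definable_add ci di.
by exists t => e; rewrite tP; case: (c e); case: (d e).
Qed.

Lemma definable_cmul c d :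
  definable_cfun c -> definable_cfun d -> definable_cfun (fun e => c e * d e).
Proof.
move=> [cr ci] [dr di]; split.
  have [t tP] := definable_add (definable_mul cr dr)
    (definable_opp (definable_mul ci di)).
  by exists t => e; rewrite tP; case: (c e); case: (d e).
have [t tP] := definable_add (definable_mul cr di) (definable_mul ci dr).
by exists t => e; rewrite tP; case: (c e); case: (d e).
Qed.

Lemma definable_csum (I : Type) (s : seq I) (c : I -> seq R -> R[i]) :
  (forall i, definable_cfun (c i)) ->
  definable_cfun (fun e => \sum_(i <- s) c i e).
Proof.
move=> dc; elim: s => [|i s IH].
  by apply: definable_cfun_ext (definable_ccst 0) => e; rewrite big_nil.
by apply: definable_cfun_ext (definable_cadd (dc i) IH) => e; rewrite big_cons.
Qed.

Lemma definable_cprod (I : Type) (s : seq I) (c : I -> seq R -> R[i]) :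
  (forall i, definable_cfun (c i)) ->
  definable_cfun (fun e => \prod_(i <- s) c i e).
Proof.
move=> dc; elim: s => [|i s IH].
  by apply: definable_cfun_ext (definable_ccst 1) => e; rewrite big_nil.
by apply: definable_cfun_ext (definable_cmul (dc i) IH) => e; rewrite big_cons.
Qed.

Lemma definable_cexp c k :
  definable_cfun c -> definable_cfun (fun e => c e ^+ k).
Proof.
move=> dc; elim: k => [|k IH].
  by apply: definable_cfun_ext (definable_ccst 1) => e; rewrite expr0.
by apply: definable_cfun_ext (definable_cmul dc IH) => e; rewrite exprS.
Qed.

Lemma definable_meval n (c : 'I_n -> seq R -> R[i]) (p : mpoly n R[i]) :
  (forall k, definable_cfun (c k)) ->
  definable_cfun (fun e => meval (fun k => c k e) p).
Proof.
move=> dc; have : definable_cfun (fun e => \sum_(m <- msupp p)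
    mcoeff m p * \prod_(k < n) c k e ^+ m k).
  apply: definable_csum => m.
  apply: definable_cmul; first exact: definable_ccst.
  by apply: definable_cprod => k; exact: definable_cexp.
by apply: definable_cfun_ext => e; rewrite mevalE.
Qed.

Lemma definable_ceq0 c : definable_cfun c -> definable (fun e => c e = 0).
Proof.
move=> [cr ci]; have := definable_and (definable_eq cr (definable_cst 0))
  (definable_eq ci (definable_cst 0)).
apply: definable_ext => e; split=> [|->//].
by case: (c e) => ? ? /= [-> ->].
Qed.

Lemma normc_sqr (z : R[i]) :
  normc z ^+ 2 =
  complex.Re z * complex.Re z + complex.Im z * complex.Im z.
Proof.
by case: z => a b /=; rewrite sqr_sqrtr -?expr2// addr_ge0// sqr_ge0.
Qed.

(** The modulus involves a square root and is not a term; its square is, which is why bounds are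
    stated for squares. *)
Lemma definable_normc_sqr c : definable_cfun c ->
  definable_fun (fun e => normc (c e) ^+ 2).
Proof.
move=> [cr ci].
have [t tP] := definable_add (definable_mul cr cr) (definable_mul ci ci).
by exists t => e; rewrite tP normc_sqr.
Qed.

End definability.

(** Turns a bound depending on [a] in an unknown way into a power of [a]: the existence of a point
    of [V a] with some squared coordinate at least [x] is definable in [a] and [x], so
    [definable_poly_bounded] applies. *)
Lemma zero_set_poly_bounded (R : rcfType) (n m l : nat)
    (p : 'I_m -> mpoly n R[i]) (q : 'I_l -> mpoly n R[i]) :
  let V a z := (forall j, meval z (q j) = 0) /\
    (forall j, normc (meval z (p j)) ^+ 2 <= a) in
  (forall a, exists b, forall z, V a z -> forall k, normc (z k) ^+ 2 < b) ->
  exists (T : R) (D : nat), 1 <= T /\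
    forall a z, T <= a -> V a z -> forall k, normc (z k) ^+ 2 < a ^+ D.
Proof.
move=> V Vb.
(* Variables 0 and 1 stand for a and x, variables 2 + k and 2 + n + k for the
   real and imaginary parts of z_k. *)
pose c (k : 'I_n) (e : seq R) : R[i] := e`_(2 + k) +i* e`_(2 + (n + k)).
pose Q e := V e`_0 (c^~ e) /\ exists k, e`_1 <= normc (c k e) ^+ 2.
have dc k : definable_cfun (c k).
  split; first exact: (definable_nth _ (2 + k)%N).
  exact: (definable_nth _ (2 + (n + k))%N).
have dQ : definable Q.
  apply: definable_and; first apply: definable_and.
  - apply: definable_forall_ord => j; apply: definable_ceq0.
    exact: definable_meval.
  - apply: definable_forall_ord => j.
    apply: definable_le; last exact: definable_nth.
    by apply: definable_normc_sqr; exact: definable_meval.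
  - apply: definable_exists_ord => k.
    by apply: definable_le; [exact: definable_nth|exact: definable_normc_sqr].
have dP := definable_exists (iota 2 (n + n)) dQ.
have [|T [D [T1 TD]]] := definable_poly_bounded dP.
  move=> a; have [b Vab] := Vb a; exists b => x bx [e' e'e [+ [k]]].
  (* Indices 0 and 1 lie outside the quantified block, so [e'] still carries [a] and [x] there. *)
  rewrite !e'e ?mem_iota//= => /Vab/(_ k) cb xc.
  by have := le_lt_trans (le_trans bx xc) cb; rewrite ltxx.
exists T, D; split=> // a z Ta Vaz k; rewrite ltNge; apply/negP => ax.
(* A point violating the bound contradicts [TD] on the boundary [x = a ^+ D] of the region. *)
apply: (TD a (a ^+ D) Ta (lexx _)).
pose e' := [:: a; a ^+ D] ++ ([seq complex.Re (z i) | i <- enum 'I_n] ++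
  [seq complex.Im (z i) | i <- enum 'I_n]).
have zE : c^~ e' =1 z.
  move=> i; rewrite /c /e' /= !nth_cat !size_map -!enumT !size_enum_ord.
  rewrite !add0n ltn_ord.
  rewrite ltnNge leq_addr /= addKn.
  rewrite !(nth_map i) -?enumT ?size_enum_ord ?ltn_ord// !nth_ord_enum.
  by case: (z i).
have size_e' : size e' = (2 + (n + n))%N.
  by rewrite /e' !size_cat !size_map -!enumT !size_enum_ord.
exists e'.
  move=> i; case: (ltnP i 2) => [|i2]; first by case: i => [|[|]].
  rewrite mem_iota i2 -leqNgt => ni.
  (* Past the block both lists have ended, and both entries are the default 0. *)
  by rewrite [LHS]nth_default ?size_e'// nth_default.
split; last by exists k; rewrite zE.
by case: Vaz => zq zp; split=> j; rewrite (meval_eq _ zE).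
Qed.

(** * The Euclidean topology of [C^n] *)

Section euclidean_topology.
Variable R : realType.

(** A filter on [S] is pushed forward along the inclusion; a cluster point of the image is one of
    the original filter, because open sets of [S] are traces of open sets of [T]. *)
Lemma compact_set_type (T : topologicalType) (S : set T) (A : set S) :
  compact (@set_val T S @` A) -> compact A.
Proof.
move=> cA F FF FA.
pose v : S -> T := set_val.
have FvA : (v @ F) (v @` A).
  by apply: (@filterS _ F _ A) => // s As /=; exists s.
have [_ [[s As <-] clu]] := cA (v @ F) _ FvA.
exists s; split=> // B C FB [C' [[D oD <-] Ds DC]].
have FvB : (v @ F) (v @` B).
  by apply: (@filterS _ F _ B) => // t Bt /=; exists t.
have [_ [[t Bt <-] Dt]] := clu _ D FvB (open_nbhs_nbhs (conj oD Ds)).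
by exists t; split=> //; exact: DC.
Qed.

Lemma max_norm_ge0 n (z : 'rV[R[i]]_n) : 0 <= max_norm z.
Proof. exact: bigmax_ge_id. Qed.

Lemma normc_le_max_norm n (z : 'rV[R[i]]_n) (k : 'I_n) :
  normc (z ord0 k) <= max_norm z.
Proof. exact: le_bigmax. Qed.

Lemma max_norm_continuous n : continuous (@max_norm R n).
Proof.
move=> z; have FF : Filter (nbhs z) := nbhs_filter z.
apply/cvgrPdist_lt => e e0.
have e0' : 0 < e%:C :> R[i] by rewrite ltcR.
apply: (@filterS _ _ (nbhs_filter z) (ball z e%:C)); last exact: nbhsx_ballx.
move=> w; rewrite -ball_normE /= => zw.
rewrite -ltcR (le_lt_trans _ zw)//.
(* In [R[i]] the maximum norm becomes the library norm, and the reverse triangle inequality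
   concludes. *)
have -> : (`|max_norm z - max_norm w|)%:C = `| `|z| - `|w| |.
  by rewrite -!max_normE -raddfB normc_def /= expr0n addr0 sqrtr_sqr.
exact: ler_dist_dist.
Qed.

Lemma real_complex_continuous : continuous (fun a : R => a%:C : R[i]).
Proof.
move=> a; apply/cvgrPdist_lt => e; case: e => e e'.
(* A positive element of [R[i]] has zero imaginary part, so the radius is real. *)
rewrite ltcE /= => /andP[/eqP -> e0]; near=> b.
rewrite -raddfB normc_def /= expr0n addr0 sqrtr_sqr ltcR.
by near: b; exact: cvgr_dist_lt.
Unshelve. all: by end_near. Qed.

(** Heine-Borel: each coordinate stays in the square of side [2 * M], a compact image of a product
    of two segments, and a product of compact sets is compact. *)
Lemma closed_max_bounded_compact n (A : set 'rV[R[i]]_n) (M : R) :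
  closed A -> (forall z, A z -> max_norm z <= M) -> compact A.
Proof.
move=> Acl AM.
have cseg : compact [set x : R[i] | exists2 p : R * R,
   ((`[- M, M]%classic `*` `[- M, M]%classic) p) & p.1 +i* p.2 = x].
  pose toC (a : R) : R[i] := a%:C.
  apply: (@continuous_compact _ _ (fun p : R * R => p.1 +i* p.2 : R[i])).
    apply: continuous_subspaceT => p.
    have -> : (fun p : R * R => p.1 +i* p.2 : R[i]) =
        (fun p => p.1%:C + 'i%C * p.2%:C).
      by apply/funext => q; rewrite [LHS]complexE.
    apply: cvgD; last apply: cvgMr.
      apply: (@continuous_comp _ _ _ (fun q : R * R => q.1) toC).
        exact: cvg_fst.
      exact: real_complex_continuous.
    apply: (@continuous_comp _ _ _ (fun q : R * R => q.2) toC).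
      exact: cvg_snd.
    exact: real_complex_continuous.
  by apply: compact_setX; exact: segment_compact.
apply: (subclosed_compact Acl (rV_compact (fun=> cseg))) => z /AM zM k.
have := le_trans (normc_le_max_norm z k) zM.
case: (z ord0 k) => a b /= abM; exists (a, b) => //=.
rewrite !in_itv /= -!ler_norml; split; apply: le_trans abM;
  by rewrite -sqrtr_sqr ler_wsqrtr// ?lerDl ?lerDr sqr_ge0.
Qed.

(** * Continuity of polynomial expressions *)

Section continuous_operations.
Variable T : topologicalType.
Implicit Types f g : T -> R[i].

Lemma eq_continuous f g : f =1 g -> continuous f -> continuous g.
Proof. by move=> /funext ->. Qed.

Lemma continuousDc f g :
  continuous f -> continuous g -> continuous (fun z => f z + g z).
Proof.
move=> cf cg z.
exact: (@cvgD _ _ _ (nbhs z) (nbhs_filter z) _ _ _ _ (cf z) (cg z)).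
Qed.

Lemma continuousMc f g :
  continuous f -> continuous g -> continuous (fun z => f z * g z).
Proof.
move=> cf cg z.
exact: (@cvgM _ _ (nbhs z) (nbhs_filter z) _ _ _ _ (cf z) (cg z)).
Qed.

Lemma continuous_sumc (I : Type) (s : seq I) (f : I -> T -> R[i]) :
  (forall i, continuous (f i)) -> continuous (fun z => \sum_(i <- s) f i z).
Proof.
move=> cf; elim: s => [|i s IH].
  apply: (@eq_continuous (fun=> 0)) => [z|]; first by rewrite big_nil.
  exact: cst_continuous.
apply: eq_continuous (continuousDc (cf i) IH) => z.
by rewrite big_cons.
Qed.

Lemma continuous_prodc (I : Type) (s : seq I) (f : I -> T -> R[i]) :
  (forall i, continuous (f i)) -> continuous (fun z => \prod_(i <- s) f i z).
Proof.
move=> cf; elim: s => [|i s IH].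
  apply: (@eq_continuous (fun=> 1)) => [z|]; first by rewrite big_nil.
  exact: cst_continuous.
apply: eq_continuous (continuousMc (cf i) IH) => z.
by rewrite big_cons.
Qed.

Lemma continuousXc f k : continuous f -> continuous (fun z => f z ^+ k).
Proof.
move=> cf; elim: k => [|k IH].
  apply: (@eq_continuous (fun=> 1)) => [z|]; first by rewrite expr0.
  exact: cst_continuous.
by apply: eq_continuous (continuousMc cf IH) => z; rewrite exprS.
Qed.

End continuous_operations.

Lemma meval_continuous n (p : mpoly n R[i]) :
  continuous (fun z : 'rV[R[i]]_n => meval (fun k => z ord0 k) p).
Proof.
have : continuous (fun z : 'rV[R[i]]_n => \sum_(m <- msupp p)
    mcoeff m p * \prod_(k < n) z ord0 k ^+ m k).
  apply: continuous_sumc => m; apply: continuousMc; first exact: cst_continuous.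
  apply: continuous_prodc => k; apply: continuousXc; exact: coord_continuous.
by apply: eq_continuous => z; rewrite mevalE.
Qed.

(** * Properness and the exponent *)

Lemma compact_max_norm_bounded n (K : set 'rV[R[i]]_n) :
  compact K -> exists M : R, forall z, K z -> max_norm z <= M.
Proof.
move=> cK.
have : compact (@max_norm R n @` K).
  apply: continuous_compact cK; apply: continuous_subspaceT => z.
  exact: max_norm_continuous.
(* Boundedness only provides the bounds strictly above [M], hence [M + 1]. *)
move=> /(@compact_bounded R R)[M [_ MK]]; exists (M + 1) => z Kz.
rewrite (le_trans (ler_norm _))//; apply: (MK (M + 1)); first by rewrite ltrDl.
by exists z.
Qed.

Lemma compact_max_norm_le n (M : R) :
  compact [set z : 'rV[R[i]]_n | max_norm z <= M].
Proof.
apply: (@closed_max_bounded_compact _ _ M) => //.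
have := (continuous_closedP (@max_norm R n)).1 (@max_norm_continuous n).
by move=> /(_ _ (@closed_le _ M)).
Qed.

Lemma polynomial_mapping_continuous n m (F : 'rV[R[i]]_n -> 'rV[R[i]]_m) :
  polynomial_mapping F -> continuous F.
Proof.
move=> [p Fp] z; have FF : Filter (nbhs z) := nbhs_filter z.
apply/cvg_ballP => e e0.
have : nbhs z (fun w => forall j, ball (F z ord0 j) e (F w ord0 j)).
  apply: (@filter_forall _ _ _ _ (nbhs_filter z)) => j.
  have /cvg_ballP/(_ e e0) := @meval_continuous n (p j) z.
  by apply: (@filterS _ _ (nbhs_filter z)) => w; rewrite !Fp.
apply: (@filterS _ _ (nbhs_filter z)) => w zw; split=> // i j.
by rewrite (ord1 i).
Qed.

Lemma algebraic_set_closed n (S : set 'rV[R[i]]_n) :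
  algebraic_set S -> closed S.
Proof.
move=> [l [q Sq]].
pose f j (z : 'rV[R[i]]_n) := meval (fun k => z ord0 k) (q j).
have -> : S = \bigcap_(j in setT) (f j @^-1` [set 0]).
  by rewrite Sq; apply/seteqP; split=> z zq j => [_|]; exact: zq.
apply: closed_bigI => j _.
apply: ((continuous_closedP _).1 (@meval_continuous n (q j))).
exact/accessible_closed_set1/hausdorff_accessible/norm_hausdorff.
Qed.


Lemma normc_ge0 (x : R[i]) : 0 <= normc x.
Proof. by case: x => a b; exact: sqrtr_ge0. Qed.

Lemma le_sqrt_sqr (x a : R) : x ^+ 2 <= a -> x <= Num.sqrt a.
Proof.
move=> xa; rewrite (le_trans (ler_norm _))// -sqrtr_sqr.
exact: ler_wsqrtr.
Qed.

Lemma max_norm_le n (z : 'rV[R[i]]_n) (M : R) : 0 <= M ->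
  (max_norm z <= M) <-> (forall k, normc (z ord0 k) <= M).
Proof.
move=> M0; split=> [zM k|zM]; first exact: le_trans (normc_le_max_norm z k) zM.
by apply/bigmax_leP; split=> // k _.
Qed.

(** Preimages are closed by continuity. They are bounded since, beyond radius [B],
    [A * |z| ^ nu <= |F z| <= M] forces [|z| <= (M / A) ^ (1 / nu)]. *)
Lemma lojasiewicz_proper n m (F : 'rV[R[i]]_n -> 'rV[R[i]]_m)
    (S : set 'rV[R[i]]_n) (nu : R) :
  continuous F -> closed S -> 0 < nu -> lojasiewicz_exponents F S nu ->
  proper_mapping (sigL S F).
Proof.
move=> cF cS nu0 [A A0 [B B0 FAB]] K cK.
have [M KM] := compact_max_norm_bounded cK.
have Kcl : closed K by apply: compact_closed cK; exact: norm_hausdorff.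
apply: compact_set_type.
have -> : @set_val _ S @` (sigL S F @^-1` K) = S `&` F @^-1` K.
  apply/seteqP; split=> [_ [z Kz <-]|z [Sz Kz]].
    by split=> //; exact: set_valP.
  by exists (exist _ z (mem_set Sz)).
apply: (@closed_max_bounded_compact _ _ (Num.max B ((M / A) `^ nu^-1))).
  apply: closedI => //; exact: (continuous_closedP F).1.
move=> z [Sz /KM FzM]; rewrite le_max; case: (leP (max_norm z) B) => //= Bz.
have := le_trans (FAB z Sz Bz) FzM; rewrite mulrC -ler_pdivlMr// => zM.
have := ge0_ler_powR (ltW _ : 0 <= nu^-1) _ _ zM.
rewrite -powRrM mulfV ?gt_eqF// powRr1 ?max_norm_ge0//; apply.
- by rewrite invr_gt0.
- by rewrite nnegrE powR_ge0.
(* The sign of [M] is not given: [0 <= M / A] follows from [zM] itself. *)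
- by rewrite nnegrE (le_trans _ zM)// powR_ge0.
Qed.

(** Properness is tested on a closed ball; the compact preimage in [S] stays compact, hence bounded,
    after inclusion in the ambient space. *)
Lemma proper_bounded_fibers n m (F : 'rV[R[i]]_n -> 'rV[R[i]]_m)
    (S : set 'rV[R[i]]_n) (M : R) : proper_mapping (sigL S F) ->
  exists b : R, forall z, S z -> max_norm (F z) <= M -> max_norm z <= b.
Proof.
move=> /(_ _ (@compact_max_norm_le m M)) cFM.
have : compact (@set_val _ S @` (sigL S F @^-1` [set w | max_norm w <= M])).
  apply: continuous_compact cFM; apply: continuous_subspaceT.
  exact: initial_continuous.
move=> /compact_max_norm_bounded[b Hb]; exists b => z Sz FzM.
by apply: Hb; exists (exist _ z (mem_set Sz)).
Qed.

Lemma proper_lojasiewicz n m (F : 'rV[R[i]]_n -> 'rV[R[i]]_m)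
    (S : set 'rV[R[i]]_n) :
  polynomial_mapping F -> algebraic_set S -> proper_mapping (sigL S F) ->
  exists2 nu : R, 0 < nu & lojasiewicz_exponents F S nu.
Proof.
move=> [p Fp] [l [q Sq]] Fproper.
have [|T [D [T1 TD]]] := @zero_set_poly_bounded R n m l p q.
  move=> a.
  have [b Hb] := @proper_bounded_fibers _ _ _ _ (Num.sqrt a) Fproper.
  (* The absolute value guards against a negative [b], and the added 1 makes the inequality
     strict. *)
  exists (`|b| ^+ 2 + 1) => z [zq zp] k.
  pose w : 'rV[R[i]]_n := \row_k z k.
  have wE : (fun k => w ord0 k) =1 z by move=> i; rewrite mxE.
  have Sw : S w by rewrite Sq => j /=; rewrite (meval_eq _ wE).
  have /(Hb _ Sw) wb : max_norm (F w) <= Num.sqrt a.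
    apply/max_norm_le; first exact: sqrtr_ge0.
    move=> j; rewrite Fp (meval_eq _ wE).
    exact/le_sqrt_sqr/zp.
  rewrite ltr_pwDr// -wE lerXn2r// ?nnegrE ?normc_ge0//.
  by rewrite (le_trans (normc_le_max_norm w k))// (le_trans wb)// ler_norm.
(* The exponent uses [D.+1] since [D] may be 0. The radius [T ^+ D] ensures that the maximum
   defining [a] below is attained by [|F z| ^ 2]. *)
exists (D.+1%:R)^-1; first by rewrite invr_gt0 ltr0n.
exists 1 => //; exists (T ^+ D).
  by rewrite exprn_gt0// (lt_le_trans _ T1).
move=> z Sz Tz; rewrite mul1r.
set a := Num.max T (max_norm (F z) ^+ 2).
have za : max_norm z ^+ 2 <= a ^+ D.
  rewrite -[leRHS]sqr_sqrtr; last first.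
    by rewrite exprn_ge0// le_max (le_trans _ T1).
  rewrite lerXn2r ?nnegrE ?max_norm_ge0 ?sqrtr_ge0//.
  apply/max_norm_le; first exact: sqrtr_ge0.
  move=> k; apply/le_sqrt_sqr/ltW/(TD a (fun k => z ord0 k)).
    by rewrite le_max lexx.
  split=> j; first by move: Sz; rewrite Sq; exact.
  rewrite -Fp le_max; apply/orP; right.
  by rewrite lerXn2r ?nnegrE ?max_norm_ge0 ?normc_ge0// normc_le_max_norm.
have z1 : 1 < max_norm z by apply: le_lt_trans Tz; exact: exprn_ege1.
(* Otherwise [a = T] and [|z| ^ 2 <= T ^ D < |z|], which is impossible for [|z| > 1]. *)
have TF : T < max_norm (F z) ^+ 2.
  rewrite ltNge; apply/negP => FT; move: za; rewrite /a max_l// leNgt.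
  by rewrite (lt_trans Tz)// expr2 ltr_pMl// (lt_trans _ z1).
have F1 : 1 <= max_norm (F z).
  have := le_lt_trans T1 TF; rewrite ltNge.
  by case: (ltP (max_norm (F z)) 1) => // /ltW ?; rewrite exprn_ile1 ?max_norm_ge0.
(* Square roots in [|z| ^ 2 <= (|F z| ^ D) ^ 2] give the power [D]; [F1] allows raising it to
   [D.+1]. *)
have zF : max_norm z <= max_norm (F z) ^+ D.+1.
  move: za; rewrite /a (max_r (ltW TF)) exprAC.
  rewrite ler_pXn2r ?nnegrE ?exprn_ge0 ?max_norm_ge0//.
  by move=> /le_trans; apply; rewrite ler_weXn2l.
have := ge0_ler_powR (_ : 0 <= (D.+1%:R)^-1 :> R) _ _ zF.
rewrite -[_ ^+ _]powR_mulrn ?max_norm_ge0// -powRrM mulfV ?pnatr_eq0//.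
rewrite powRr1 ?max_norm_ge0//.
by apply; rewrite ?nnegrE ?powR_ge0 ?max_norm_ge0.
Qed.

End euclidean_topology.

Theorem corollary2 (R : realType) (n m : nat) (hn : (2 <= n)%N)
    (F : 'rV[R[i]]_n -> 'rV[R[i]]_m) (hF : polynomial_mapping F)
    (S : set 'rV[R[i]]_n) (hS : algebraic_set S) (hSu : ~ bounded_set S) :
  proper_mapping (sigL S F) <-> (0 < lojasiewicz_exponent_infty F S)%E.
Proof.
split=> [/(proper_lojasiewicz hF hS)[nu nu0 Fnu]|].
  apply: (@lt_le_trans _ _ nu%:E); first by rewrite lte_fin.
  by apply: ereal_sup_ubound; exists nu.
(* A positive supremum is not that of the empty set, and some admissible exponent is itself
   positive. *)
move=> /ereal_sup_gt[_ [nu Fnu <-]]; rewrite lte_fin => nu0.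
apply: lojasiewicz_proper nu0 Fnu; last exact: algebraic_set_closed.
exact: polynomial_mapping_continuous.
Qed.
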